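(* Each of the set-valued permutation statistics $\operatorname{Asc}$ (ascent set), $\operatorname{Val}$ (valley set), $\operatorname{Lval}$ (left valley set), $\operatorname{Rval}$ (right valley set), and $\operatorname{Eval}$ (exterior valley set) is shuffle compatible.
   Context: For a finite set $U$ of positive integers, a permutation of $U$ is a linear order $\pi=\pi_1\pi_2\cdots\pi_m$ of all the elements of $U$ (each appearing exactly once); write $\operatorname{dom}(\pi)=U$, $|\pi|=|U|=m$, and let $L(U)$ be the set of permutations of $U$. Two permutations $\pi\in L(U)$, $\pi'\in L(V)$ with $|U|=|V|$ have the same relative order if applying the unique strictly increasing bijection $U\to V$ to the entries of $\pi$ gives $\pi'$. A permutation statistic is a map $\operatorname{St}$ defined on all permutations of all finite sets of positive integers such that $\operatorname{St}(\pi)=\operatorname{St}(\pi')$ whenever $\pi$ and $\pi'$ have the same relative order. For permutations $\pi,\sigma$ with disjoint domains, the shuffle set $\operatorname{Sh}(\pi,\sigma)$ is the set of all $\tau\in L(\operatorname{dom}(\pi)\sqcup\operatorname{dom}(\sigma))$ containing both $\pi$ and $\sigma$ as (not necessarily contiguous) subwords. For a set $\Pi$ of permutations, $\operatorname{St}(\Pi)$ denotes the multiset $\{\{\operatorname{St}(\pi) : \pi\in\Pi\}\}$. A permutation statistic $\operatorname{St}$ is shuffle compatible if for all permutations $\pi,\pi',\sigma,\sigma'$ with $|\pi|=|\pi'|$, $|\sigma|=|\sigma'|$, $\operatorname{dom}(\pi)\cap\operatorname{dom}(\sigma)=\operatorname{dom}(\pi')\cap\operatorname{dom}(\sigma')=\emptyset$,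 $\operatorname{St}(\pi)=\operatorname{St}(\pi')$ and $\operatorname{St}(\sigma)=\operatorname{St}(\sigma')$, one has the equality of multisets $\operatorname{St}(\operatorname{Sh}(\pi,\sigma))=\operatorname{St}(\operatorname{Sh}(\pi',\sigma'))$. For $\pi=\pi_1\cdots\pi_m$: $\operatorname{Asc}(\pi)=\{i\in[m-1] : \pi_i<\pi_{i+1}\}$; $\operatorname{Val}(\pi)=\{i : 2\le i\le m-1,\ \pi_{i-1}>\pi_i<\pi_{i+1}\}$. Put $\pi_0=\infty$ and $\pi_{m+1}=\infty$ (an added $\infty$ at position $0$ and an added $\infty$ at position $m+1$). Then $\operatorname{Lval}(\pi)$ is the set of valleys of $\infty\pi$, i.e. $\{i : 1\le i\le m-1,\ \pi_{i-1}>\pi_i<\pi_{i+1}\}$; $\operatorname{Rval}(\pi)$ is the set of valleys of $\pi\infty$, i.e. $\{i : 2\le i\le m,\ \pi_{i-1}>\pi_i<\pi_{i+1}\}$; and $\operatorname{Eval}(\pi)$ is the set of valleys of $\infty\pi\infty$, i.e. $\{i : 1\le i\le m,\ \pi_{i-1}>\pi_i<\pi_{i+1}\}$. *)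

(* Defs.v *)
From HB Require Import structures.
From mathcomp Require Import all_boot.
From mathcomp Require Import finmap.

Set Implicit Arguments.
Unset Strict Implicit.
Unset Printing Implicit Defensive.

Local Open Scope fset_scope.
Local Open Scope nat_scope.

(* A permutation of a finite set of positive integers is encoded by its word;
   the set itself is recovered as [dom]. *)
Definition is_permutation (pi : seq nat) : bool := uniq pi && (0 \notin pi).

Definition dom (pi : seq nat) : {fset nat} := [fset x in pi].

(* [permutations] lists every permutation exactly once. *)
Definition L (U : {fset nat}) : seq (seq nat) := permutations (enum_fset U).

Definition same_relative_order (pi pi' : seq nat) : Prop :=
  exists f : nat -> nat,
    [/\ {in dom pi &, {homo f : x y / x < y}},
        [fset f x | x in dom pi] = dom pi' & map f pi = pi'].

(* Statistics are total functions on words, but their values on words that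
   are not permutations play no role. *)
Definition permutation_statistic (T : eqType) (St : seq nat -> T) : Prop :=
  forall pi pi' : seq nat, is_permutation pi -> is_permutation pi' ->
    same_relative_order pi pi' -> St pi = St pi'.

(* The shuffle set, as a duplicate-free list. *)
Definition Sh (pi sigma : seq nat) : seq (seq nat) :=
  [seq tau <- L (dom pi `|` dom sigma) | subseq pi tau && subseq sigma tau].

(* Equality of multisets is [perm_eq] of the lists of values. *)
Definition shuffle_compatible (T : eqType) (St : seq nat -> T) : Prop :=
  permutation_statistic St /\
  forall pi pi' sigma sigma' : seq nat,
    is_permutation pi -> is_permutation pi' ->
    is_permutation sigma -> is_permutation sigma' ->
    size pi = size pi' -> size sigma = size sigma' ->
    dom pi `&` dom sigma = fset0 -> dom pi' `&` dom sigma' = fset0 ->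
    St pi = St pi' -> St sigma = St sigma' ->
    perm_eq [seq St tau | tau <- Sh pi sigma]
            [seq St tau | tau <- Sh pi' sigma'].

(* The letter at position [i], counted from 1; [None] stands for infinity,
   which thus sits at positions 0 and [(size pi).+1]. *)
Definition letter (pi : seq nat) (i : nat) : option nat :=
  if i is j.+1 then onth pi j else None.

Definition lt_infty (x y : option nat) : bool :=
  match x, y with
  | Some a, Some b => a < b
  | Some _, None => true
  | None, _ => false
  end.

Definition valley_at (pi : seq nat) (i : nat) : bool :=
  lt_infty (letter pi i) (letter pi i.-1) &&
  lt_infty (letter pi i) (letter pi i.+1).

(* [index_iota a b] lists the integers i with a <= i < b. *)
Definition Asc (pi : seq nat) : {fset nat} :=
  [fset i in index_iota 1 (size pi) | lt_infty (letter pi i) (letter pi i.+1)].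

Definition Val (pi : seq nat) : {fset nat} :=
  [fset i in index_iota 2 (size pi) | valley_at pi i].

Definition Lval (pi : seq nat) : {fset nat} :=
  [fset i in index_iota 1 (size pi) | valley_at pi i].

Definition Rval (pi : seq nat) : {fset nat} :=
  [fset i in index_iota 2 (size pi).+1 | valley_at pi i].

Definition Eval (pi : seq nat) : {fset nat} :=
  [fset i in index_iota 1 (size pi).+1 | valley_at pi i].

(* Main.v *)
Require Import Defs.
From mathcomp Require Import all_boot.
From mathcomp Require Import finmap.
From mathcomp Require Import zify.

(** All five statistics record the positions at which the two neighbours of a
letter pass a test that only compares that letter with them (or with the
infinity beyond an end of the word): [window_set].  Two observations make any
such statistic shuffle compatible.

Crossing.  Let [a] be a letter of [p] and [b > a] a letter of [q], with no
letter of either word strictly between them.  Exchanging the values [a] and [b]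
changes neither the relative order of [p] nor that of [q], and it does not
change the multiset of values of the statistic on the shuffles: in a shuffle
where [a] and [b] are not neighbours, the exchange preserves all comparisons
between neighbours; a shuffle where they are neighbours is, as it stands, also
a shuffle of the two new words ([perm_Sh_swap]).  Each crossing lowers the sum
of the letters of [q], so after finitely many of them every letter of [p]
exceeds every letter of [q] ([perm_Sh_separate]).

Domination.  When every letter of [p] exceeds every letter of [q], a letter of
[p] that has a letter of [q] on a side where the test wants something larger
fails the test; otherwise the neighbours that matter are its neighbours in [p],
so the outcome is read off from the value of the statistic on [p].  Hence, with
the interleaving and the order within [q] kept, [p] can be replaced by any
dominating word of the same length and the same value ([window_set_shuffle]).

Together, replacing one of the two shuffled words by another of the same length
and value preserves the multiset ([perm_Sh_eq_l]).  Since shuffling is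
symmetric, this is applied to each word in turn, going through a translate of
[p'] that is disjoint from both [q] and [q']. *)

Set Implicit Arguments.
Unset Strict Implicit.
Unset Printing Implicit Defensive.

Local Open Scope nat_scope.

(** * Sequences and relabellings *)

Lemma bijective_perm_eq (A B C : eqType) (s : seq A) (t : seq B)
    (f : A -> B) (g : B -> A) (F : A -> C) (G : B -> C) :
  uniq s -> uniq t ->
  {in s, forall x, f x \in t} -> {in t, forall y, g y \in s} ->
  {in s, cancel f g} -> {in t, cancel g f} ->
  {in s, forall x, F x = G (f x)} -> perm_eq (map F s) (map G t).
Proof.
move=> us ut fst gts fK gK FG.
have -> : map F s = map G (map f s) by rewrite -map_comp; apply/eq_in_map.
apply: perm_map; apply: uniq_perm => //.
  by rewrite map_inj_in_uniq //; apply: can_in_inj fK.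
move=> y; apply/mapP/idP => [[x xs ->]|yt]; first exact: fst.
by exists (g y); [apply: gts | rewrite gK].
Qed.

(** Words of equal length over distinct letters differ by a relabelling of the
letters; this lets every word below be compared with its image by a function. *)
Lemma exists_map_eq (s t : seq nat) :
  uniq s -> size s = size t -> exists f : nat -> nat, map f s = t.
Proof.
move=> us st; exists (fun x => nth 0 t (index x s)).
apply: (@eq_from_nth _ 0); rewrite size_map // => i ilt.
by rewrite (nth_map 0) // index_uniq.
Qed.

Lemma inj_in_of_uniq_map (f : nat -> nat) (s : seq nat) :
  uniq (map f s) -> {in s &, injective f}.
Proof.
move=> ufs; have [g gE] := exists_map_eq ufs (size_map f s).
by apply: (@can_in_inj _ _ _ _ g); apply/eq_in_map; rewrite map_id -[RHS]gE -map_comp.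
Qed.

(** With [v] the part of a shuffle that follows some letter, and [p] selecting
one of the shuffled words: the next letter in that word either is the next
letter of the shuffle or is hidden behind a letter of the other word. *)
Lemma ohead_filter (p : pred nat) (v : seq nat) :
  ohead (filter p v) = ohead v \/ exists2 y, ohead v = Some y & ~~ p y.
Proof.
case: v => [|y v] /=; first by left.
by case: ifP => py; [left | right; exists y => //; rewrite py].
Qed.

Lemma infix2_cons (x y : nat) (u v : seq nat) :
  ohead v = Some y -> infix [:: x; y] (u ++ x :: v).
Proof.
by case: v => [//|_ v [->]]; apply/infixP; exists u, v.
Qed.

Lemma infix2_rev (x y : nat) (u v : seq nat) :
  ohead (rev u) = Some y -> infix [:: y; x] (u ++ x :: v).
Proof.
case/lastP: u => [//|u z]; rewrite rev_rcons => -[->].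
by apply/infixP; exists u, v; rewrite cat_rcons.
Qed.

Lemma infix2_map (f : nat -> nat) (x y : nat) (s : seq nat) :
  infix [:: x; y] s -> infix [:: f x; f y] (map f s).
Proof.
by case/infixP=> u [v ->]; rewrite !map_cat; apply/infixP; exists (map f u), (map f v).
Qed.

Lemma infix2_mem (x y : nat) (s : seq nat) :
  infix [:: x; y] s -> x \in s /\ y \in s.
Proof.
by case/infixP=> u [v ->]; rewrite !mem_cat !inE !eqxx !orbT.
Qed.

(** * Statistics read through a window *)

(** The flag [e] decides how a letter compares with the end of the word: [true]
puts infinity there, [false] puts a letter smaller than all others. *)
Definition below (e : bool) (x y : option nat) : bool :=
  if x is Some a then if y is Some b then a < b else e else false.

(** The flag [c] switches off the test on the left neighbour, which turns
valleys into ascents. *)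
Definition window (c e0 e1 : bool) (l x r : option nat) : bool :=
  (c || below e0 x l) && below e1 x r.

Definition window_set (c e0 e1 : bool) (s : seq nat) : {fset nat} :=
  [fset i in index_iota 1 (size s).+1 |
    window c e0 e1 (letter s i.-1) (letter s i) (letter s i.+1)]%fset.

Lemma letter_map f s i : letter (map f s) i = omap f (letter s i).
Proof. by case: i => //= i; rewrite onth_map. Qed.

Lemma onth_ge (s : seq nat) i : size s <= i -> onth s i = None.
Proof. by elim: s i => [|x s IH] [|i] //= /IH. Qed.

Lemma onth_lt (s : seq nat) i : i < size s -> onth s i = Some (nth 0 s i).
Proof. by elim: s i => [|x s IH] [|i] //= /IH. Qed.

#[local] Arguments onth : simpl never.

Lemma AscE : Asc =1 window_set true true false.
Proof.
move=> s; apply/fsetP => i; rewrite !inE !mem_index_iota /window /=.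
case: i => // i /=; case: (ltnP i (size s)) => [ilt|ige]; last first.
  by rewrite [_ < size s]ltnNge (leqW ige) ltnS ltnNge ige.
rewrite ltnS ilt (onth_lt ilt) /=.
case: (ltnP i.+1 (size s)) => [h|h]; first by rewrite (onth_lt h).
by rewrite (onth_ge h).
Qed.

(** Excluding an end position from the range amounts to having a small letter
beyond that end, since a valley must lie below both neighbours. *)
Lemma window_set_valleyE (e0 e1 : bool) s :
  window_set false e0 e1 s =
  [fset i in index_iota (~~ e0).+1 (size s + e1) | valley_at s i]%fset.
Proof.
apply/fsetP => i; rewrite !inE !mem_index_iota /window /valley_at /=.
case: i => [//|i]; rewrite -[i.+1.-1]/i -[letter s i.+1]/(onth s i).
case: (ltnP i (size s)) => [ilt|ige]; last first.
  by rewrite (onth_ge ige) /= !andbF.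
rewrite (onth_lt ilt) !ltnS ilt andTb.
have -> : below e0 (Some (nth 0 s i)) (letter s i)
        = (~~ e0 <= i) && lt_infty (Some (nth 0 s i)) (letter s i).
  case: i ilt => [|i] ilt /=; first by case: e0.
  by rewrite (onth_lt (ltnW ilt)); case: e0.
have -> : below e1 (Some (nth 0 s i)) (onth s i.+1)
        = (i.+1 < size s + e1) && lt_infty (Some (nth 0 s i)) (onth s i.+1).
  case: (ltnP i.+1 (size s)) => [h|h].
    by rewrite (onth_lt h) (leq_trans h) ?leq_addr.
  rewrite (onth_ge h) /=; case: e1; rewrite /= ?addn1 ?addn0 ?ltnS ?ilt //.
  by rewrite ltnNge h.
by rewrite andbACA.
Qed.

Lemma ValE : Val =1 window_set false false false.
Proof. by move=> s; rewrite window_set_valleyE addn0. Qed.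

Lemma LvalE : Lval =1 window_set false true false.
Proof. by move=> s; rewrite window_set_valleyE addn0. Qed.

Lemma RvalE : Rval =1 window_set false false true.
Proof. by move=> s; rewrite window_set_valleyE addn1. Qed.

Lemma EvalE : Eval =1 window_set false true true.
Proof. by move=> s; rewrite window_set_valleyE addn1. Qed.

(** Splitting the word at a letter rather than indexing its positions lets the
windows of a shuffle be compared with those of its two filtered subwords. *)
Lemma window_set_map c e0 e1 (f : nat -> nat) (s : seq nat) :
  window_set c e0 e1 s = window_set c e0 e1 (map f s) <->
  forall u x v, s = u ++ x :: v ->
    window c e0 e1 (ohead (rev u)) (Some x) (ohead v) =
    window c e0 e1 (omap f (ohead (rev u))) (Some (f x)) (omap f (ohead v)).
Proof.
have lettersE u x v : [/\ letter (u ++ x :: v) (size u) = ohead (rev u),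
    letter (u ++ x :: v) (size u).+1 = Some x &
    letter (u ++ x :: v) (size u).+2 = ohead v].
  split=> /=.
  - case/lastP: u => [//|u y]; rewrite size_rcons rev_rcons /= cat_rcons.
    by rewrite onth_cat ltnn subnn.
  - by rewrite onth_cat ltnn subnn.
  - by rewrite onth_cat ltnNge leqnSn subSnn; case: v.
split=> [/fsetP eqs u x v es|eqs].
  move: (eqs (size u).+1); rewrite !inE !mem_index_iota size_map !letter_map es.
  have [-> -> ->] := lettersE u x v.
  by rewrite size_cat addnS !ltnS leq_addr.
apply/fsetP => i; rewrite !inE !mem_index_iota size_map.
case: i => [//|i]; case: (ltnP i (size s)) => [ilt|ige]; last first.
  by rewrite !ltnS ltnNge ige.
rewrite !ltnS ilt /= !onth_map letter_map.
have es := esym (cat_take_drop i s); rewrite (drop_nth 0 ilt) in es.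
have := eqs _ _ _ es; have := lettersE (take i s) (nth 0 s i) (drop i.+1 s).
by rewrite -es size_take ilt /= => -[-> -> ->].
Qed.

Lemma window_set_map_adjacent c e0 e1 (f : nat -> nat) (s : seq nat) :
  (forall x y, infix [:: x; y] s ->
    (f x < f y) = (x < y) /\ (f y < f x) = (y < x)) ->
  window_set c e0 e1 s = window_set c e0 e1 (map f s).
Proof.
move=> fs; apply/window_set_map => u x v es; congr (_ && _).
  case E: (ohead (rev u)) => [y|] //=; congr (_ || _).
  by have [] := fs y x; rewrite // es; apply: infix2_rev.
case E: (ohead v) => [y|] //=.
by have [] := fs x y; rewrite // es; apply: infix2_cons.
Qed.

Lemma window_set_mono c e0 e1 (f : nat -> nat) (s : seq nat) :
  {in s &, {mono f : x y / x < y}} ->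
  window_set c e0 e1 s = window_set c e0 e1 (map f s).
Proof.
move=> fs; apply: window_set_map_adjacent => x y /infix2_mem[xs ys].
by rewrite !fs.
Qed.

(** * Shuffles *)

(** Being a shuffle is expressed by two filters, which commute with relabelling
and with concatenation, unlike subword tests. *)
Lemma mem_Sh (p q t : seq nat) : uniq (p ++ q) ->
  (t \in Sh p q) = ([seq x <- t | x \in p] == p) && ([seq x <- t | x \notin p] == q).
Proof.
move=> upq; have domE : perm_eq (enum_fset (dom p `|` dom q)%fset) (p ++ q).
  apply: uniq_perm => // x.
  by rewrite -[_ \in enum_fset _]/(x \in (dom p `|` dom q)%fset) !inE mem_cat.
rewrite mem_filter mem_permutations (permPr domE).
move: (upq); rewrite cat_uniq => /and3P[up /hasPn qNp uq].
apply/andP/andP => [[/andP[spt sqt] ptpq]|[/eqP tp /eqP tq]].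
  have ut : uniq t by rewrite (perm_uniq ptpq).
  split; first by rewrite -(subseq_uniqP ut spt).
  rewrite {1}(subseq_uniqP ut sqt); apply/eqP/eq_in_filter => x.
  rewrite (perm_mem ptpq) mem_cat => /orP[xp|xq].
    by rewrite xp; apply/esym/negbTE/negP => /qNp; rewrite xp.
  by rewrite xq; apply: qNp.
split; first by rewrite -{1}tp -tq !filter_subseq.
by rewrite -{1}tp -tq perm_sym perm_filterC.
Qed.

Lemma Sh_uniq p q : uniq (Sh p q).
Proof. by rewrite filter_uniq // permutations_uniq. Qed.

Lemma Sh_sym p q : Sh p q = Sh q p.
Proof. by rewrite /Sh fsetUC; apply: eq_filter => t; rewrite andbC. Qed.

Lemma Sh_perm p q t : uniq (p ++ q) -> t \in Sh p q -> perm_eq t (p ++ q).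
Proof.
move=> upq; rewrite mem_Sh // => /andP[/eqP tp /eqP tq].
by rewrite -{1}tp -tq perm_sym perm_filterC.
Qed.

Lemma map_Sh (f : nat -> nat) p q t : uniq (p ++ q) ->
  {in p ++ q &, injective f} -> t \in Sh p q ->
  map f t \in Sh (map f p) (map f q).
Proof.
move=> upq finj tS; have tE := perm_mem (Sh_perm upq tS).
move: tS; rewrite !mem_Sh // -?map_cat ?map_inj_in_uniq //.
have fp : {in t, forall x, (f x \in map f p) = (x \in p)}.
  move=> x; rewrite tE => xt; apply/mapP/idP => [[y yp]|xp]; last by exists x.
  by move/finj->; rewrite // mem_cat yp.
case/andP=> /eqP tp /eqP tq; rewrite !filter_map.
apply/andP; split; apply/eqP; [rewrite -[in RHS]tp | rewrite -[in RHS]tq];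
  congr map;
  by apply: eq_in_filter => x xt /=; rewrite fp.
Qed.

Lemma perm_Sh_map (T : eqType) (F : seq nat -> T) (f : nat -> nat) p q :
  uniq (p ++ q) -> {in p ++ q &, injective f} ->
  {in Sh p q, forall t, F t = F (map f t)} ->
  perm_eq [seq F t | t <- Sh p q] [seq F t | t <- Sh (map f p) (map f q)].
Proof.
move=> upq finj Ff; have upq' : uniq (map f (p ++ q)) by rewrite map_inj_in_uniq.
have [g gE] := exists_map_eq upq' (size_map f (p ++ q)).
have fK : {in p ++ q, cancel f g}.
  by apply/eq_in_map; rewrite map_id -[RHS]gE -map_comp.
have gK : {in map f (p ++ q), cancel g f}.
  by move=> _ /mapP[x xpq ->]; rewrite fK.
apply: (@bijective_perm_eq _ _ _ _ _ (map f) (map g)) => //; try exact: Sh_uniq.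
- by move=> t; apply: map_Sh.
- have [gp gq] : map g (map f p) = p /\ map g (map f q) = q.
    move: gE; rewrite !map_cat => /eqP.
    by rewrite eqseq_cat ?size_map // => /andP[/eqP-> /eqP->].
  move=> t tS; rewrite -[p]gp -[q]gq.
  apply: map_Sh; rewrite -?map_cat //; exact: can_in_inj gK.
- move=> t tS; rewrite -map_comp -[RHS]map_id; apply/eq_in_map => x xt.
  by apply: fK; rewrite -(perm_mem (Sh_perm upq tS)).
- move=> t tS; rewrite -map_comp -[RHS]map_id; apply/eq_in_map => x xt.
  by apply: gK; rewrite map_cat -(perm_mem (Sh_perm _ tS)) // -map_cat.
Qed.

(** * Crossing two letters with consecutive values *)

Definition swap (a b x : nat) : nat := if x == a then b else if x == b then a else x.

Definition adjacent (a b : nat) (t : seq nat) : bool :=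
  infix [:: a; b] t || infix [:: b; a] t.

Lemma swapK a b : involutive (swap a b).
Proof.
move=> x; rewrite /swap; case: (eqVneq x a) => [->|xa].
  by rewrite eqxx; case: eqVneq.
case: (eqVneq x b) => [->|xb]; first by rewrite eqxx.
by rewrite (negbTE xa) (negbTE xb).
Qed.

Lemma swap_l a b : swap a b a = b.
Proof. by rewrite /swap eqxx. Qed.

Lemma swap_r a b : swap a b b = a.
Proof. by rewrite /swap eqxx; case: eqVneq. Qed.

Lemma swap_id a b x : x != a -> x != b -> swap a b x = x.
Proof. by rewrite /swap => /negbTE-> /negbTE->. Qed.

(** With nothing between [a] and [b], no third letter sees the exchange: only
the comparison of [a] with [b] is reversed. *)
Lemma swap_lt a b x y : a < b -> ~~ (a < x < b) -> ~~ (a < y < b) ->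
  ~~ ((x == a) && (y == b)) -> ~~ ((x == b) && (y == a)) ->
  (swap a b x < swap a b y) = (x < y).
Proof.
rewrite /swap; case: (x =P a) => xa; case: (x =P b) => xb;
  case: (y =P a) => ya; case: (y =P b) => yb //=; lia.
Qed.

Lemma mem_map_swap a b x s : (x \in map (swap a b) s) = (swap a b x \in s).
Proof. by rewrite -{1}(swapK a b x) mem_map //; apply: inv_inj (swapK a b). Qed.

Lemma adjacent_map_swap a b t : adjacent a b t -> adjacent a b (map (swap a b) t).
Proof.
rewrite /adjacent => /orP[] /(infix2_map (swap a b));
by rewrite swap_l swap_r => ->; rewrite ?orbT.
Qed.

Lemma map_swapK a b : involutive (map (swap a b)).
Proof. by move=> t; rewrite -map_comp -[RHS]map_id; apply: eq_map => x; apply: swapK. Qed.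

(** If [P] holds for exactly one of two neighbours [a] and [b], the subword that
[P] selects cannot tell in which order they stand. *)
Lemma filter_swap_adjacent (P : pred nat) a b t : uniq t -> adjacent a b t ->
  P a = ~~ P b -> filter P (map (swap a b) t) = filter P t.
Proof.
move=> ut adj Pab.
have fixed w : a \notin w -> b \notin w -> map (swap a b) w = w.
  move=> aw bw; apply: map_id_in => x xw; apply: swap_id.
    by apply: contraNneq aw => <-.
  by apply: contraNneq bw => <-.
by case/orP: adj => /infixP[u [v et]]; move: ut; rewrite et !map_cat /= swap_l swap_r;
  rewrite cat_uniq /= !inE !negb_or => /and4P[_ /and3P[au bu _] /andP[_ av] /andP[bv _]];
  rewrite !fixed // !filter_cat /= Pab; case: (P b).
Qed.

(** The bijection between the two shuffle sets leaves a shuffle alone if [a] and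
[b] are neighbours in it, and exchanges their values otherwise. *)
Lemma perm_Sh_swap c e0 e1 a b p q :
  uniq (p ++ q) -> a \in p -> b \in q -> a < b ->
  {in p ++ q, forall x, ~~ (a < x < b)} ->
  perm_eq [seq window_set c e0 e1 t | t <- Sh p q]
    [seq window_set c e0 e1 t | t <- Sh (map (swap a b) p) (map (swap a b) q)].
Proof.
move=> upq ap bq ltab gap.
have bNp : b \notin p by move: upq; rewrite cat_uniq => /and3P[_ /hasPn/(_ b bq)].
have sinj : injective (swap a b) := inv_inj (swapK a b).
have upq' : uniq (map (swap a b) p ++ map (swap a b) q).
  by rewrite -map_cat map_inj_uniq.
pose phi t := if adjacent a b t then t else map (swap a b) t.
have phiK : involutive phi.
  move=> t; rewrite {2}/phi; case: ifP => [adj|nadj]; rewrite /phi ?adj //.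
  case: ifP => [/adjacent_map_swap|_]; last exact: map_swapK.
  by rewrite map_swapK nadj.
have phiSh p' q' : uniq (p' ++ q') ->
    (a \in p') = (b \notin p') -> 
    {in Sh p' q', forall t, phi t \in Sh (map (swap a b) p') (map (swap a b) q')}.
  move=> u' ab' t tS; rewrite /phi; case: ifP => adj; last first.
    by apply: map_Sh => // x y _ _; apply: sinj.
  rewrite mem_Sh -?map_cat ?map_inj_uniq // in tS *.
  have ut : uniq t by rewrite (perm_uniq (Sh_perm u' tS)).
  move: tS; rewrite !mem_Sh -?map_cat ?map_inj_uniq // => /andP[/eqP tp /eqP tq].
  apply/andP; split; apply/eqP.
    rewrite -(@filter_swap_adjacent _ a b) //; last first.
      by rewrite !mem_map_swap swap_l swap_r ab' negbK.
    rewrite filter_map -[in RHS]tp; congr map; apply: eq_filter => x /=.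
    by rewrite mem_map_swap swapK.
  rewrite -(@filter_swap_adjacent _ a b) //; last first.
    by rewrite !mem_map_swap swap_l swap_r ab' negbK.
  rewrite filter_map -[in RHS]tq; congr map; apply: eq_filter => x /=.
  by rewrite mem_map_swap swapK.
apply: (@bijective_perm_eq _ _ _ _ _ phi phi) => //; try exact: Sh_uniq.
- by apply: phiSh; rewrite // ap bNp.
- move=> t tS; rewrite -[p](map_swapK a b) -[q](map_swapK a b).
  by apply: phiSh; rewrite // !mem_map_swap swap_l swap_r ap (negbTE bNp).
- move=> t tS; rewrite /phi; case: ifP => // /negbT; rewrite negb_or => /andP[nab nba].
apply: window_set_map_adjacent => x y xy.
have [] := infix2_mem xy; rewrite !(perm_mem (Sh_perm upq tS)) => xpq ypq.
have xy_ab : ~~ ((x == a) && (y == b)).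
  by apply: contra nab => /andP[/eqP<- /eqP<-].
have xy_ba : ~~ ((x == b) && (y == a)).
  by apply: contra nba => /andP[/eqP<- /eqP<-].
have gx := gap x xpq; have gy := gap y ypq.
by rewrite !swap_lt // andbC.
Qed.

Lemma swap_mono a b (s : seq nat) : a < b -> (a \notin s) || (b \notin s) ->
  {in s, forall x, ~~ (a < x < b)} -> {in s &, {mono swap a b : x y / x < y}}.
Proof.
move=> ltab nab gap x y xs ys.
apply: swap_lt => //; [exact: gap | exact: gap | |];
  by apply: contraL nab => /andP[/eqP<- /eqP<-]; rewrite xs ys.
Qed.

Lemma sumn_map_swap a b s : uniq s -> b \in s -> a \notin s -> a < b ->
  sumn (map (swap a b) s) < sumn s.
Proof.
move=> us bs aNs ltab; have sE := perm_to_rem bs.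
rewrite (perm_sumn sE) (perm_sumn (perm_map _ sE)) /= swap_r map_id_in ?ltn_add2r //.
move=> x; rewrite mem_rem_uniq // => /andP[/= xb xs]; apply: swap_id => //.
by apply: contraNneq aNs => <-.
Qed.

(** A pair [a < b] at minimal distance has no letter strictly between, as such a
letter would form a closer pair with [a] or with [b]. *)
Lemma closest_pair p q : uniq (p ++ q) ->
  {in p & q, forall x y, y < x} \/
  exists a b, [/\ a \in p, b \in q, a < b & {in p ++ q, forall x, ~~ (a < x < b)}].
Proof.
move=> upq.
pose P d := has (fun a => has (fun b => (a < b) && (b - a == d)) q) p.
case: (boolP (has (fun a => has (fun b => a < b) q) p)) => [H|/hasPn H]; last first.
  left=> x y xp yq; have /hasPn/(_ y yq) := H x xp; rewrite -leqNgt leq_eqVlt.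
  case/orP=> [/eqP yx|//]; move: upq; rewrite cat_uniq => /and3P[_ /hasPn/(_ y yq)].
  by rewrite /= yx xp.
have exP : exists d, P d.
  case/hasP: H => a ap /hasP[b bq ltab]; exists (b - a).
  by apply/hasP; exists a => //; apply/hasP; exists b; rewrite // ltab /=.
right; case: (ex_minnP exP) => d /hasP[a ap /hasP[b bq /andP[ltab /eqP dE]]] dmin.
exists a, b; split=> // x; rewrite mem_cat => xpq; apply/negP => /andP[ax xb].
have : d <= b - x \/ d <= x - a; last by lia.
case/orP: xpq => [xp|xq]; [left|right]; apply: dmin.
  by apply/hasP; exists x => //; apply/hasP; exists b; rewrite // xb /=.
by apply/hasP; exists a => //; apply/hasP; exists x; rewrite // ax /=.
Qed.

(** Crossings terminate because each of them replaces [b] in [q] by the smaller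
[a].  The result is a single relabelling of both words, monotone on each. *)
Lemma perm_Sh_separate c e0 e1 p q : uniq (p ++ q) ->
  exists f : nat -> nat,
  [/\ {in p &, {mono f : x y / x < y}}, {in q &, {mono f : x y / x < y}},
     {in p & q, forall x y, f y < f x} &
     perm_eq [seq window_set c e0 e1 t | t <- Sh p q]
             [seq window_set c e0 e1 t | t <- Sh (map f p) (map f q)]].
Proof.
have [n] := ubnP (sumn q); elim: n => // n IHn in p q * => leqn upq.
have [sep|[a [b [ap bq ltab gap]]]] := closest_pair upq.
  by exists id; split=> //; rewrite !map_id.
have [up /hasPn disj uq] := and3P (etrans (esym (cat_uniq p q)) upq).
have bNp : b \notin p := disj b bq.
have aNq : a \notin q by apply: contraL ap => /disj.
have upq' : uniq (map (swap a b) p ++ map (swap a b) q).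
  by rewrite -map_cat map_inj_uniq //; apply: inv_inj (swapK a b).
have [|f [fp fq fpq fperm]] := IHn (map (swap a b) p) (map (swap a b) q) _ upq'.
  exact: leq_trans (sumn_map_swap uq bq aNq ltab) leqn.
have sp : {in p &, {mono swap a b : x y / x < y}}.
  by apply: swap_mono; rewrite // ?bNp ?orbT // => x xp; apply: gap; rewrite mem_cat xp.
have sq : {in q &, {mono swap a b : x y / x < y}}.
  by apply: swap_mono; rewrite // ?aNq // => x xq; apply: gap; rewrite mem_cat xq orbT.
exists (f \o swap a b); split.
- by move=> x y xp yp /=; rewrite fp ?map_f // sp.
- by move=> x y xq yq /=; rewrite fq ?map_f // sq.
- by move=> x y xp yq /=; rewrite fpq ?map_f.
rewrite (map_comp f _ p) (map_comp f _ q).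
by apply: perm_trans fperm; apply: perm_Sh_swap.
Qed.

(** * Shuffling with a dominating word *)

(** At a letter of [q], its neighbours from [p] are larger both before and after
relabelling, and its neighbours from [q] compare as before.  At a letter of [p],
either a neighbour from [q] makes the test fail both before and after, or the
test agrees with the one made inside [p]. *)
Lemma window_set_shuffle c e0 e1 (f : nat -> nat) p q t :
  uniq (p ++ q) -> t \in Sh p q ->
  {in p & q, forall x y, y < x} -> {in p & q, forall x y, f y < f x} ->
  {in q &, {mono f : x y / x < y}} ->
  window_set c e0 e1 p = window_set c e0 e1 (map f p) ->
  window_set c e0 e1 t = window_set c e0 e1 (map f t).
Proof.
move=> upq tS sep fsep fq /window_set_map wp; apply/window_set_map => u x v et.
have tE := perm_mem (Sh_perm upq tS).
move: tS; rewrite mem_Sh // et => /andP[/eqP tp /eqP tq].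
have tpq y : y \in t -> y \notin p -> y \in q.
  by rewrite tE mem_cat => /orP[->|].
have ut y : ohead (rev u) = Some y -> y \in t.
  by move=> yu; have [] := infix2_mem (infix2_rev x v yu); rewrite et.
have vt y : ohead v = Some y -> y \in t.
  by move=> yv; have [] := infix2_mem (infix2_cons x u yv); rewrite et.
have xt : x \in t by rewrite et mem_cat inE eqxx orbT.
have sepF y z : y \in p -> z \in q -> (y < z) = false.
  by move=> yp zq; rewrite ltnNge ltnW // sep.
have fsepF y z : y \in p -> z \in q -> (f y < f z) = false.
  by move=> yp zq; rewrite ltnNge ltnW // fsep.
rewrite !filter_cat /= in tp tq.
case: (boolP (x \in p)) => xp; rewrite ?xp ?(negbTE xp) /= in tp tq.
  have := wp _ _ _ (esym tp); rewrite -filter_rev.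
  rewrite /window.
  case: (ohead_filter (mem p) v) => [->|[y yv yNp]]; last first.
    have yq := tpq _ (vt _ yv) yNp.
    by rewrite yv /= sepF // fsepF // !andbF.
  case: (ohead_filter (mem p) (rev u)) => [->//|[y yu yNp]].
  have yq := tpq _ (ut _ yu) yNp.
  rewrite yu /= sepF // fsepF //.
  (* The left test is waived if [c] holds, and fails on both sides otherwise. *)
  by case: (c).
have xq := tpq x xt xp.
rewrite /window; congr (_ && _).
  case yu: (ohead (rev u)) => [y|] //=; congr (_ || _).
  have yt := ut y yu; case: (boolP (y \in p)) => yp; first by rewrite sep ?fsep.
  by rewrite fq // tpq.
case yv: (ohead v) => [y|] //=.
have yt := vt y yv; case: (boolP (y \in p)) => yp; first by rewrite sep ?fsep.
by rewrite fq // tpq.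
Qed.

(** * Shuffle compatibility *)

(** Once [p] and [p'] have been made to dominate [q], the two situations differ
by a relabelling [h] that is monotone on the image of [q]. *)
Lemma perm_Sh_eq_l c e0 e1 p p' q : uniq (p ++ q) -> uniq (p' ++ q) ->
  size p = size p' -> window_set c e0 e1 p = window_set c e0 e1 p' ->
  perm_eq [seq window_set c e0 e1 t | t <- Sh p q]
          [seq window_set c e0 e1 t | t <- Sh p' q].
Proof.
move=> upq upq' sp wpp'.
have [f [fp fq fpq permf]] := perm_Sh_separate c e0 e1 upq.
have [g [gp gq gpq permg]] := perm_Sh_separate c e0 e1 upq'.
have sep_inj r h : {in r &, {mono h : x y / x < y}} -> {in q &, {mono h : x y / x < y}} ->
    {in r & q, forall x y, h y < h x} -> {in r ++ q &, injective h}.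
  move=> hr hq hrq x y; rewrite !mem_cat => /orP[xr|xq] /orP[yr|yq] hxy.
  - by have := hr x y xr yr; have := hr y x yr xr; rewrite hxy ltnn; case: ltngtP.
  - by have := hrq x y xr yq; rewrite hxy ltnn.
  - by have := hrq y x yr xq; rewrite hxy ltnn.
  - by have := hq x y xq yq; have := hq y x yq xq; rewrite hxy ltnn; case: ltngtP.
have uf : uniq (map f p ++ map f q).
  by rewrite -map_cat map_inj_in_uniq //; apply: sep_inj.
have ug : uniq (map g p' ++ map g q).
  by rewrite -map_cat map_inj_in_uniq //; apply: sep_inj.
have [|h] := exists_map_eq (t := map g p' ++ map g q) uf.
  by rewrite !size_cat !size_map sp.
rewrite map_cat => /eqP; rewrite eqseq_cat ?size_map // => /andP[/eqP hp /eqP hq].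
apply: perm_trans permf _; rewrite perm_sym; apply: perm_trans permg _.
rewrite perm_sym -hp -hq.
have hinj : {in map f p ++ map f q &, injective h}.
  by apply: inj_in_of_uniq_map; rewrite // map_cat hp hq.
have hfq : {in q, forall x, h (f x) = g x}.
  by apply/eq_in_map; rewrite -hq -map_comp.
apply: perm_Sh_map => // t tS; apply: window_set_shuffle tS _ _ _ _ => //.
- by move=> _ _ /mapP[x xp ->] /mapP[y yq ->]; apply: fpq.
- move=> x _ /(map_f h) + /mapP[y yq ->]; rewrite hp hfq // => /mapP[z zp' ->].
  exact: gpq.
- by move=> _ _ /mapP[x xq ->] /mapP[y yq ->]; rewrite !hfq // fq // gq.
by rewrite hp -!window_set_mono.
Qed.

Lemma shuffle_compatible_window_set c e0 e1 :
  shuffle_compatible (window_set c e0 e1).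
Proof.
split=> [p p' _ _ [f [fp _ <-]]|p p' q q'].
  apply: window_set_mono => x y xp yp.
  have fp' z w : z \in p -> w \in p -> z < w -> f z < f w.
    by move=> zp wp; apply: fp; rewrite inE.
  case: (ltngtP x y) => [|/fp'|->]; [exact: fp'| |by rewrite ltnn].
  by move=> /(_ yp xp) fyx; rewrite ltnNge ltnW.
move=> /andP[up _] /andP[up' _] /andP[uq _] /andP[uq' _] sp sq dpq dpq' wp wq.
have catP r s : uniq r -> uniq s -> (dom r `&` dom s = fset0)%fset -> uniq (r ++ s).
  move=> ur us drs; rewrite cat_uniq ur us andbT; apply/hasPn => x xs; apply/negP=> xr.
  by have := in_fset0 x; rewrite -drs !inE xr xs.
(* Translating by more than all letters of [q] and [q'] gives a word disjoint
   from both, with the relative order of [p']. *)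
pose N := (sumn (q ++ q')).+1; pose p1 := map (addn N) p'.
have N_gt x : x \in q ++ q' -> x < N.
  by move=> xq; rewrite /N (perm_sumn (perm_to_rem xq)) /= ltnS leq_addr.
have up1 r : uniq r -> {subset r <= q ++ q'} -> uniq (p1 ++ r).
  move=> ur rq; rewrite cat_uniq ur map_inj_uniq ?up' //=; last exact: addnI.
  rewrite andbT; apply/hasPn => x /rq/N_gt xN; apply/negP=> /mapP[y _ xE].
  by move: xN; rewrite xE ltnNge leq_addr.
have wp1 : window_set c e0 e1 p' = window_set c e0 e1 p1.
  by apply: window_set_mono => x y _ _; rewrite ltn_add2l.
have sp1 : size p1 = size p' by rewrite size_map.
have up1q : uniq (p1 ++ q) by apply: up1 => // x xq; rewrite mem_cat xq.
have up1q' : uniq (p1 ++ q') by apply: up1 => // x xq; rewrite mem_cat xq orbT.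
have upq := catP _ _ up uq dpq; have upq' := catP _ _ up' uq' dpq'.
have step1 := perm_Sh_eq_l upq up1q (etrans sp (esym sp1)) (etrans wp wp1).
have uqp1 : uniq (q ++ p1) by rewrite uniq_catC.
have uqp1' : uniq (q' ++ p1) by rewrite uniq_catC.
have step2 := perm_Sh_eq_l uqp1 uqp1' sq wq.
have step3 := perm_Sh_eq_l up1q' upq' sp1 (esym wp1).
by apply: perm_trans step1 (perm_trans _ step3); rewrite Sh_sym [Sh p1 q']Sh_sym.
Qed.

Lemma eq_shuffle_compatible (T : eqType) (F G : seq nat -> T) :
  F =1 G -> shuffle_compatible G -> shuffle_compatible F.
Proof.
move=> FG [statG shG]; split=> [p p' pp pp'|p p' q q' pp pp' pq pq' sp sq dpq dpq'].
  by rewrite !FG; apply: statG.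
by rewrite !FG !(eq_map FG); apply: shG.
Qed.

Theorem theorem4p3 :
  [/\ shuffle_compatible Asc,
      shuffle_compatible Val,
      shuffle_compatible Lval,
      shuffle_compatible Rval
    & shuffle_compatible Eval].
Proof.
split.
- exact: eq_shuffle_compatible AscE (shuffle_compatible_window_set _ _ _).
- exact: eq_shuffle_compatible ValE (shuffle_compatible_window_set _ _ _).
- exact: eq_shuffle_compatible LvalE (shuffle_compatible_window_set _ _ _).
- exact: eq_shuffle_compatible RvalE (shuffle_compatible_window_set _ _ _).
- exact: eq_shuffle_compatible EvalE (shuffle_compatible_window_set _ _ _).
Qed.
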